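(* An initial subdomain of $\mathbf{No}$ is discrete if and only if it is an initial subdomain of $\mathbf{Oz}$.
   Context: The underlying set theory is NBG with global choice; structures may have proper-class universes. A domain is a commutative integral domain with $1$; subdomains contain $1$. $\mathbf{No}$ is Conway's ordered field of surreal numbers, with its tree structure: a surreal number is identified with a sequence of signs $-,+$ indexed by an ordinal; $x<_s y$ (''$x$ is simpler than $y$'', ''$x$ is a predecessor of $y$'') means that $x$ is a proper initial segment of $y$; and $<$ is the lexicographic order determined by $-<\text{undefined}<+$. Addition and multiplication are Conway's. For classes $L<R$ of surreals, $\{L\,|\,R\}$ denotes the simplest surreal lying strictly between them, when it exists. A subclass $A$ of a class $B\subseteq\mathbf{No}$ is initial in $B$ if $x\in A$, $y\in B$ and $y<_s x$ imply $y\in A$; an initial subdomain of $\mathbf{No}$ (of $\mathbf{Oz}$) is a subdomain that is initial in $\mathbf{No}$ (in $\mathbf{Oz}$). $\mathbf{Oz}$ is the subring of omnific integers: the surreals $x$ with $x=\{x-1\,|\,x+1\}$; equivalently, those whose Conway normal form $\sum_{\alpha<\beta}\omega^{y_\alpha}\cdot r_\alpha$ ($(y_\alpha)$ strictly decreasing surreals, $r_\alpha$ nonzero reals) has $y_\alpha\ge 0$ for all $\alpha<\beta$ and $r_\alpha\in\mathbb{Z}$ if $y_\alpha=0$. An ordered domain is discrete if its additive ordered group has a least positive element. *)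

(* Defs.v *)
From HB Require Import structures.
From Stdlib Require Import Wellfounded.
From mathcomp Require Import all_boot all_order.
From mathcomp Require Import generic_quotient boolp classical_sets.

Set Implicit Arguments.
Unset Strict Implicit.
Unset Printing Implicit Defensive.

Import Order.TTheory.
Local Open Scope order_scope.
Local Open Scope classical_set_scope.

(** * Ordinals

    The sets of the underlying set theory are the types of the universe from
    which [T] is taken below; classes are predicates on larger types, and [Ord],
    [No] play the role of proper classes.  A tree [wtree_node f] names the least
    ordinal strictly above all the ordinals named by the [f i]; every ordinal is
    named in this way, and trees naming the same ordinal are identified. *)

Inductive wtree : Type := wtree_node (T : Type) (f : T -> wtree).

Fixpoint wtree_le (s t : wtree) : Prop :=
  match s, t with
  | wtree_node T f, wtree_node U g =>
      forall i : T, exists j : U, wtree_le (f i) (g j)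
  end.

HB.instance Definition _ := gen_eqMixin wtree.
HB.instance Definition _ := gen_choiceMixin wtree.

Lemma wtree_le_refl t : wtree_le t t.
Proof. by elim: t => T f IH i; exists i; apply: IH. Qed.

Lemma wtree_le_trans s t u : wtree_le s t -> wtree_le t u -> wtree_le s u.
Proof.
elim: s t u => T f IH [U g] [V h] st tu i.
by have [j fg] := st i; have [k gh] := tu j; exists k; apply: IH gh.
Qed.

Lemma wtree_le_total s t : wtree_le s t \/ wtree_le t s.
Proof.
elim: s t => T f IH [U g].
have [|/existsNP [i /forallNP Ni]] :=
  pselect (wtree_le (wtree_node f) (wtree_node g)); first by left.
by right=> j; exists i; have [/Ni|] := IH i (g j).
Qed.

Lemma wtree_leNlt s t : ~ wtree_le s t ->
  match s with wtree_node T f => exists i : T, wtree_le t (f i) end.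
Proof.
elim: s t => T f IH [U g] /existsNP[i /forallNP Ni]; exists i.
have := fun j => IH i (g j) (Ni j); case: (f i) => V h hg.
exact: hg.
Qed.

Definition wtree_eqv (s t : wtree) : bool := `[< wtree_le s t /\ wtree_le t s >].

Lemma wtree_eqv_refl : reflexive wtree_eqv.
Proof. by move=> t; apply/asboolP; split; apply: wtree_le_refl. Qed.

Lemma wtree_eqv_sym : symmetric wtree_eqv.
Proof. by move=> s t; apply: asbool_equiv_eq; split=> -[]. Qed.

Lemma wtree_eqv_trans : transitive wtree_eqv.
Proof.
move=> t s u /asboolP[st ts] /asboolP[tu ut]; apply/asboolP.
by split; [apply: wtree_le_trans tu | apply: wtree_le_trans ts].
Qed.

Canonical wtree_eqv_equiv :=
  EquivRel wtree_eqv wtree_eqv_refl wtree_eqv_sym wtree_eqv_trans.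

Definition Ord : Type := {eq_quot wtree_eqv}%qT.
HB.instance Definition _ := Choice.on Ord.
HB.instance Definition _ := EqQuotient.on Ord.

Definition Ord_le (a b : Ord) : bool := `[< wtree_le (repr a) (repr b) >].

Lemma Ord_le_refl : reflexive Ord_le.
Proof. by move=> a; apply/asboolP; apply: wtree_le_refl. Qed.

Lemma Ord_le_anti : antisymmetric Ord_le.
Proof.
move=> a b /andP[/asboolP ab /asboolP ba].
by rewrite -[a]reprK -[b]reprK; apply/eqmodP/asboolP.
Qed.

Lemma Ord_le_trans : transitive Ord_le.
Proof.
by move=> b a c /asboolP ab /asboolP bc; apply/asboolP; apply: wtree_le_trans bc.
Qed.

Lemma Ord_le_total : total Ord_le.
Proof.
move=> a b; apply/orP.
by have [ab|ba] := wtree_le_total (repr a) (repr b); [left|right]; apply/asboolP.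
Qed.

Fact Ord_display : Order.disp_t. Proof. exact: Order.Disp tt tt. Qed.
HB.instance Definition _ := Order.Le_isPOrder.Build Ord_display Ord
  Ord_le_refl Ord_le_anti Ord_le_trans.
HB.instance Definition _ := Order.POrder_isTotal.Build Ord_display Ord
  Ord_le_total.

Lemma Ord_lt_wf : well_founded (fun a b : Ord => a < b).
Proof.
suff wf t s : wtree_le s t -> Acc (fun a b : Ord => a < b) (\pi_Ord s)%qT.
  by move=> a; rewrite -[a]reprK; apply: wf (wtree_le_refl _).
elim: t s => T f IH s st; constructor=> a a_lt_s.
have /wtree_leNlt : ~ wtree_le s (repr a).
  move=> sa; move: a_lt_s; rewrite ltNge => /negP; apply; apply/asboolP.
  apply: wtree_le_trans sa.
  have /eqmodP/asboolP[] : (\pi_Ord (repr (\pi_Ord s)) = \pi_Ord s)%qT.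
    by rewrite reprK.
  by [].
case: s st {a_lt_s} => U g gf [i agi]; have [j gfij] := gf i.
by rewrite -[a]reprK; apply: (IH j); apply: wtree_le_trans gfij.
Qed.

Definition Ord0 : Ord :=
  (\pi_Ord (wtree_node (fun v : void => match v with end)))%qT.

Definition Ord1 : Ord :=
  (\pi_Ord (wtree_node (fun _ : unit => repr Ord0)))%qT.

(** * Surreal numbers as sign sequences *)

Inductive sign : Type := Minus | Plus.

(** [sgn x a] is the sign of [x] at place [a], and [None] ("undefined") when [a]
    is not smaller than the length of [x]. *)
Record No : Type := MkNo {
  len : Ord;
  sgn : Ord -> option sign;
  sgnP : forall a, isSome (sgn a) = (a < len)
}.

HB.instance Definition _ := gen_eqMixin No.
HB.instance Definition _ := gen_choiceMixin No.

Lemma No_eqP (x y : No) : sgn x =1 sgn y -> x = y.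
Proof.
case: x y => [a s sP] [b t tP] /= /funext st; rewrite -{}st {t} in tP *.
have ab : a = b.
  apply: le_anti; apply/andP; split; rewrite leNgt; apply/negP.
    by rewrite -sP tP ltxx.
  by rewrite -tP sP ltxx.
by rewrite -{}ab {b} in tP *; congr MkNo; apply: Prop_irrelevance.
Qed.

(** - < undefined < + *)
Definition sign_lt (u v : option sign) : bool :=
  match u, v with
  | Some Minus, None | Some Minus, Some Plus | None, Some Plus => true
  | _, _ => false
  end.

Definition No_lt (x y : No) : bool :=
  `[< exists a : Ord, (forall b, b < a -> sgn x b = sgn y b) /\
                      sign_lt (sgn x a) (sgn y a) >].

Lemma No_lt_irr : irreflexive No_lt.
Proof. by move=> x; apply/asboolP => -[a [_]]; case: (sgn x a) => [[]|]. Qed.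

Lemma No_lt_trans : transitive No_lt.
Proof.
move=> y x z /asboolP[a [xya ltxy]] /asboolP[b [yzb ltyz]]; apply/asboolP.
case: (ltgtP a b) => [ab|ba|ab].
- exists a; split=> [c ca|]; last by rewrite -yzb.
  by rewrite xya // yzb // (lt_trans ca).
- exists b; split=> [c cb|]; last by rewrite xya.
  by rewrite xya ?yzb // (lt_trans cb).
- rewrite -{}ab in yzb ltyz; exists a; split=> [c ca|]; first by rewrite xya ?yzb.
  by move: ltxy ltyz; case: (sgn x a) (sgn y a) (sgn z a) => [[]|] [[]|] [[]|].
Qed.

Fact No_display : Order.disp_t. Proof. exact: Order.Disp tt tt. Qed.
HB.instance Definition _ := Order.Lt_isPOrder.Build No_display No
  No_lt_irr No_lt_trans.

Lemma Ord_least (P : set Ord) : P !=set0 ->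
  exists2 a, P a & forall b, b < a -> ~ P b.
Proof.
move=> [a]; elim/(well_founded_ind Ord_lt_wf): a => a IH Pa.
by have [[b [/IH]]|/forallNP Nb] := pselect (exists b, b < a /\ P b);
  [|exists a => // b ba Pb; apply: (Nb b)].
Qed.

Lemma No_le_total : total (<=%O : rel No).
Proof.
move=> x y; apply/orP; have [->|xy] := pselect (x = y); first by left.
have [|a Da Na] := @Ord_least [set a | sgn x a <> sgn y a].
  by apply/existsNP => xy'; apply: xy; apply: No_eqP.
have xya b : b < a -> sgn x b = sgn y b by move/Na/contrapT.
suff: sign_lt (sgn x a) (sgn y a) \/ sign_lt (sgn y a) (sgn x a).
  case=> lta; [left|right]; apply: ltW; apply/asboolP; exists a; split=> // b ba.
  by rewrite xya.
by move: Da => /=; case: (sgn x a) (sgn y a) => [[]|] [[]|] //; auto.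
Qed.
HB.instance Definition _ := Order.POrder_isTotal.Build No_display No No_le_total.

(** [simpler x y]: [x] is a proper initial segment of [y]. *)
Definition simpler (x y : No) : Prop :=
  len x < len y /\ forall a, a < len x -> sgn x a = sgn y a.

Lemma simpler_wf : well_founded simpler.
Proof.
apply: (@wf_incl _ _ (fun x y => len x < len y)); first by move=> x y [].
exact: (wf_inverse_image _ _ _ len Ord_lt_wf).
Qed.

(** [is_cut L R z]: [z] is [{ L | R }], the simplest surreal strictly between
    [L] and [R]; there is at most one such [z]. *)
Definition between (L R : set No) : set No :=
  [set z | (forall l, L l -> l < z) /\ (forall r, R r -> z < r)].

Definition is_cut (L R : set No) (z : No) : Prop :=
  between L R z /\ forall y, between L R y -> y = z \/ simpler z y.

Lemma const_signP (s : sign) (a b : Ord) :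
  isSome (if b < a then Some s else None) = (b < a).
Proof. by case: ifP. Qed.

Definition No_zero : No := MkNo (const_signP Plus Ord0).
Definition No_one : No := MkNo (const_signP Plus Ord1).

(** [{ L | R }], with an irrelevant value when it does not exist *)
Definition cut (L R : set No) : No := xget No_zero (is_cut L R).

(** The canonical representation of [x] is [{ Lopt x | Ropt x }]. *)
Definition Lopt (x : No) : set No := [set y | simpler y x /\ y < x].
Definition Ropt (x : No) : set No := [set y | simpler y x /\ x < y].

(** * Conway's operations

    They are defined by recursion on simplicity, [x^L] and [x^R] ranging over
    [Lopt x] and [Ropt x]; the defining equations are [No_oppE], [No_addE] and
    [No_mulE]. *)

Definition No_rec (T : Type)
    (F : forall x, (forall y, simpler y x -> T) -> T) : No -> T :=
  Fix simpler_wf (fun=> T) F.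

Lemma No_recE (T : Type) (F : forall x, (forall y, simpler y x -> T) -> T) x :
  No_rec F x = F x (fun y _ => No_rec F y).
Proof.
rewrite /No_rec Fix_eq // => {}x f g fg; congr F.
by apply: functional_extensionality_dep => y; apply: funext => h; apply: fg.
Qed.

Definition No_opp : No -> No := No_rec (fun x opp =>
  cut [set z | exists y (h : simpler y x), x < y /\ z = opp y h]
      [set z | exists y (h : simpler y x), y < x /\ z = opp y h]).

Definition No_add : No -> No -> No := No_rec (fun x addx => No_rec (fun y addy =>
  cut ([set z | exists x' (h : simpler x' x), x' < x /\ z = addx x' h y] `|`
       [set z | exists y' (h : simpler y' y), y' < y /\ z = addy y' h])
      ([set z | exists x' (h : simpler x' x), x < x' /\ z = addx x' h y] `|`
       [set z | exists y' (h : simpler y' y), y < y' /\ z = addy y' h]))).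

Declare Scope surreal_scope.
Delimit Scope surreal_scope with No.
Bind Scope surreal_scope with No.
Notation "0" := No_zero : surreal_scope.
Notation "1" := No_one : surreal_scope.
Notation "- x" := (No_opp x) : surreal_scope.
Notation "x + y" := (No_add x y) : surreal_scope.
Notation "x - y" := (No_add x (No_opp y)) : surreal_scope.
Local Open Scope surreal_scope.

Definition No_mul : No -> No -> No := No_rec (fun x mulx => No_rec (fun y muly =>
  let term x' (h : simpler x' x) y' (k : simpler y' y) :=
    mulx x' h y + muly y' k - mulx x' h y' in
  cut ([set z | exists x' h y' k, [/\ x' < x, y' < y & z = term x' h y' k]] `|`
       [set z | exists x' h y' k, [/\ x < x', y < y' & z = term x' h y' k]])
      ([set z | exists x' h y' k, [/\ x' < x, y < y' & z = term x' h y' k]] `|`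
       [set z | exists x' h y' k, [/\ x < x', y' < y & z = term x' h y' k]]))).

Notation "x * y" := (No_mul x y) : surreal_scope.

Lemma No_oppE x : - x = cut [set - y | y in Ropt x] [set - y | y in Lopt x].
Proof.
rewrite {1}/No_opp No_recE -/No_opp; congr cut; apply/seteqP; split=> z /=.
- by move=> [y [h [xy ->]]]; exists y.
- by move=> [y [h xy] <-]; exists y, h.
- by move=> [y [h [xy ->]]]; exists y.
- by move=> [y [h xy] <-]; exists y, h.
Qed.

Lemma No_addE x y : x + y =
  cut ([set x' + y | x' in Lopt x] `|` [set x + y' | y' in Lopt y])
      ([set x' + y | x' in Ropt x] `|` [set x + y' | y' in Ropt y]).
Proof.
have E : No_add x = No_rec _ := No_recE _ x.
rewrite {1}E No_recE -E -/No_add; congr cut; apply/seteqP; split=> z /= [] .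
- by move=> [x' [h [lt ->]]]; left; exists x'.
- by move=> [y' [h [lt ->]]]; right; exists y'.
- by move=> [x' [h lt] <-]; left; exists x', h.
- by move=> [y' [h lt] <-]; right; exists y', h.
- by move=> [x' [h [lt ->]]]; left; exists x'.
- by move=> [y' [h [lt ->]]]; right; exists y'.
- by move=> [x' [h lt] <-]; left; exists x', h.
- by move=> [y' [h lt] <-]; right; exists y', h.
Qed.

Lemma No_mulE x y : x * y =
  cut ([set x' * y + x * y' - x' * y' | x' in Lopt x & y' in Lopt y] `|`
       [set x' * y + x * y' - x' * y' | x' in Ropt x & y' in Ropt y])
      ([set x' * y + x * y' - x' * y' | x' in Lopt x & y' in Ropt y] `|`
       [set x' * y + x * y' - x' * y' | x' in Ropt x & y' in Lopt y]).
Proof.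
have E : No_mul x = No_rec _ := No_recE _ x.
rewrite {1}E No_recE -E -/No_mul.
by congr cut; apply/seteqP; split=> z /= [] ;
  solve [ move=> [x' [h [y' [k [lt1 lt2 ->]]]]];
          ((by left; exists x' => //; exists y') ||
           (by right; exists x' => //; exists y'))
        | move=> [x' [h lt1] [y' [k lt2] <-]];
          ((by left; exists x', h, y', k) || (by right; exists x', h, y', k)) ].
Qed.

(** * Omnific integers, initial and discrete subdomains *)

Definition Oz : set No := [set x | is_cut [set x - 1] [set x + 1] x].

Definition initial_in (B A : set No) : Prop :=
  A `<=` B /\ forall x y, A x -> B y -> simpler y x -> A y.

(** A subring, containing [1], of a subring [B] of the field [No]; it is a domain
    as [No] is a field. *)
Definition subdomain_of (B A : set No) : Prop :=
  [/\ A `<=` B, A 1, forall x y, A x -> A y -> A (x - y)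
    & forall x y, A x -> A y -> A (x * y)].

Definition initial_subdomain_of (B A : set No) : Prop :=
  subdomain_of B A /\ initial_in B A.

Definition discrete (A : set No) : Prop :=
  exists e, [/\ A e, 0 < e & forall x, A x -> 0 < x -> e <= x].

(* Main.v *)
(* Let [A] be discrete with least positive element [e].  If [e < 1], then 0
   and 1 are options of [e], so the definition of the product gives
   [0 < e * e < e], a contradiction; hence [e = 1].  Now let [x] be in [A] and
   [x - 1 < y < x + 1].  If [x] is not an initial segment of [y], the longest
   common initial segment of [x] and [y] is a proper initial segment of [x], hence
   in [A], and it is at distance less than 1 from [x], which is absurd.  So [x]
   is the simplest element of the interval.  Conversely, an omnific integer
   strictly between 0 and 1 would be simpler than 0. *)
Require Import Defs.
From mathcomp Require Import all_boot all_order.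
From mathcomp Require Import boolp classical_sets.
From mathcomp Require Import generic_quotient.

Set Implicit Arguments.
Unset Strict Implicit.
Unset Printing Implicit Defensive.

Import Order.TTheory.
Local Open Scope order_scope.
Local Open Scope classical_set_scope.
Local Open Scope surreal_scope.

(** * The order of ordinals in terms of the trees naming them *)

Lemma pi_leP s t : reflect (wtree_le s t) (\pi_Ord s <= \pi_Ord t)%qT.
Proof.
have eqv u : wtree_le u (repr (\pi_Ord u)%qT) /\ wtree_le (repr (\pi_Ord u)%qT) u.
  have /eqmodP/asboolP[] : (\pi_Ord (repr (\pi_Ord u)) = \pi_Ord u)%qT.
    by rewrite reprK.
  by [].
have [[s1 s2] [t1 t2]] := (eqv s, eqv t).
apply: (iffP (asboolP _)) => h.
  exact: wtree_le_trans s1 (wtree_le_trans h t2).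
exact: wtree_le_trans s2 (wtree_le_trans h t1).
Qed.

Lemma wtree_node_nle T (f : T -> wtree) i : ~ wtree_le (wtree_node f) (f i).
Proof.
(* Stated for a whole tree, so that the induction hypothesis speaks of the children of each
   [f i]. *)
suff: forall t, match t with wtree_node T f => forall i, ~ wtree_le t (f i) end.
  by move/(_ (wtree_node f)); apply.
elim=> {i}T {}f IH i; have := IH i.
by case Efi: (f i) => [U g] Ng /(_ i)[j]; rewrite Efi => /Ng.
Qed.

Lemma lt_pi_node T (f : T -> wtree) (a : Ord) :
  a < (\pi_Ord (wtree_node f))%qT <-> exists i, a <= (\pi_Ord (f i))%qT.
Proof.
split=> [|[i]].
  by rewrite -[a]reprK ltNge => /pi_leP/wtree_leNlt[i /pi_leP]; exists i.
by move/le_lt_trans; apply; rewrite ltNge; apply/pi_leP/wtree_node_nle.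
Qed.

Lemma ltr_Ord0 (a : Ord) : (a < Ord0) = false.
Proof. by apply/negP => /lt_pi_node[[]]. Qed.

Lemma lt_Ord1 (a : Ord) : (a < Ord1) = (a == Ord0).
Proof.
have le0 b : Ord0 <= b by rewrite leNgt ltr_Ord0.
apply/idP/eqP => [/lt_pi_node[_]|->]; last by apply/lt_pi_node; exists tt.
by rewrite reprK => a0; apply/le_anti; rewrite a0 le0.
Qed.

(** Induction gives a bound for each child of a tree naming [a]; a node over the same index type,
    whose children also dominate the values of [h] at the children, lies above all of them. *)
Lemma Ord_replacement (h : Ord -> Ord) (a : Ord) :
  exists b, forall c, c < a -> h c < b.
Proof.
rewrite -[a]reprK; elim: (repr a) => T f IH.
have [B HB] := choice IH.
exists (\pi_Ord (wtree_node (fun i =>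
  repr (Order.max (B i) (h (\pi_Ord (f i))))))%qT)%qT.
move=> c /lt_pi_node[i]; rewrite le_eqVlt => ci; apply/lt_pi_node; exists i.
rewrite reprK le_max; case/orP: ci => [/eqP ->|/HB/ltW -> //].
by rewrite lexx orbT.
Qed.

(** * Initial segments *)

Lemma sgn_out x a : len x <= a -> sgn x a = None.
Proof. by move=> xa; have := sgnP x a; rewrite ltNge xa; case: sgn. Qed.

Lemma restr_signP x a b :
  isSome (if b < a then sgn x b else None) = (b < Order.min a (len x)).
Proof. by rewrite lt_min; case: ifP => //= _; apply: sgnP. Qed.

Definition restr (x : No) (a : Ord) : No := MkNo (restr_signP x a).

Lemma simpler_restr x a : a < len x -> simpler (restr x a) x.
Proof.
by move=> ax; split=> [|c] /=; rewrite (min_idPl (ltW ax)) // => ->.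
Qed.

(** Predecessors of [y] are thus indexed by the ordinals below its length, which brings
    [Ord_replacement] to bear on them. *)
Lemma simpler_restrE x y : simpler x y -> x = restr y (len x).
Proof.
move=> [xy sxy]; apply: No_eqP => c /=.
by case: ltP => [/sxy //|]; apply: sgn_out.
Qed.

Lemma simpler_irr x : ~ simpler x x.
Proof. by case; rewrite ltxx. Qed.

Lemma simpler_trans y x z : simpler x y -> simpler y z -> simpler x z.
Proof.
move=> [xy sxy] [yz syz]; split; first exact: lt_trans yz.
by move=> a ax; rewrite sxy // syz // (lt_trans ax).
Qed.

Lemma simpler_comparable x y z : simpler x z -> simpler y z ->
  [\/ simpler x y, x = y | simpler y x].
Proof.
move=> xz yz; case: (ltgtP (len x) (len y)) => [xy|yx|e].
- apply: Or31; split=> // a ax.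
  by case: xz yz => _ sx [_ sy]; rewrite sx ?sy // (lt_trans ax).
- apply: Or33; split=> // a ay.
  by case: xz yz => _ sx [_ sy]; rewrite sy ?sx // (lt_trans ay).
- by apply: Or32; rewrite (simpler_restrE xz) (simpler_restrE yz) e.
Qed.

Lemma sgn_len_simpler x y : simpler x y ->
  sgn y (len x) = Some (if x < y then Plus else Minus).
Proof.
move=> [xy sxy]; have := sgnP y (len x); rewrite xy.
have sx : sgn x (len x) = None by apply: sgn_out.
case Ey: sgn => [[]|] // _.
  suff /ltW : y < x by rewrite leNgt => /negbTE ->.
  by apply/asboolP; exists (len x); rewrite sx Ey; split=> // a /sxy.
suff -> : x < y by [].
by apply/asboolP; exists (len x); rewrite sx Ey.
Qed.

(* If neither [x] nor [y] is an initial segment of the other, the witness is their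
   longest common initial segment. *)
Lemma lt_split x y : x < y ->
  [\/ simpler x y, simpler y x
    | exists w, [/\ simpler w x, simpler w y, x < w & w < y]].
Proof.
move=> /asboolP[a [xya lta]].
case Ex: (sgn x a) lta => [[]|]; case Ey: (sgn y a) => [[]|] // _.
- have ax : a < len x by rewrite -sgnP Ex.
  have ay : a < len y by rewrite -sgnP Ey.
  have le : len (restr x a) = a by rewrite /= (min_idPl (ltW ax)).
  have ry : restr x a = restr y a.
    by apply: No_eqP => c /=; case: ifP => // /xya.
  apply: Or33; exists (restr x a); split;
    [exact: simpler_restr| |apply/asboolP|apply/asboolP].
  + by rewrite ry; apply: simpler_restr.
  + by exists a; rewrite Ex /= ltxx; split=> // c ->.
  + by exists a; rewrite Ey /= ltxx; split=> // c ca; rewrite ca xya.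
- apply: Or32; split=> [|c].
    rewrite -sgnP; have : ~~ (a < len y) by rewrite -sgnP Ey.
    rewrite -leNgt le_eqVlt => /orP[/eqP ->|ya]; first by rewrite Ex.
    by rewrite sgnP (lt_trans ya) // -sgnP Ex.
  move=> cy; rewrite xya //; apply: lt_le_trans cy _.
  by rewrite leNgt -sgnP Ey.
- apply: Or31; split=> [|c].
    rewrite -sgnP; have : ~~ (a < len x) by rewrite -sgnP Ex.
    rewrite -leNgt le_eqVlt => /orP[/eqP ->|xa]; first by rewrite Ey.
    by rewrite sgnP (lt_trans xa) // -sgnP Ey.
  move=> cx; rewrite xya //; apply: lt_le_trans cx _.
  by rewrite leNgt -sgnP Ex.
Qed.

(** * Cuts *)

(** Bounded length plays the role of being a set: it ensures that the gap between two classes is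
    inhabited. *)
Definition small (L : set No) : Prop := exists b, forall l, L l -> len l < b.

Lemma smallU L R : small L -> small R -> small (L `|` R).
Proof.
move=> [a La] [b Rb]; exists (Order.max a b) => l [/La|/Rb] h.
  by rewrite lt_max h.
by rewrite lt_max h orbT.
Qed.

(** Members of [P] are restrictions of [x], so the bounds for the [F y] are indexed by the ordinals
    below [len x] and have a common bound by [Ord_replacement]. *)
Lemma small_bigcup (x : No) (P : set No) (F : No -> set No) :
  (forall y, P y -> simpler y x) -> (forall y, P y -> small (F y)) ->
  small (\bigcup_(y in P) F y).
Proof.
move=> Px sF.
have /choice[B HB] : forall y, exists b, P y -> forall l, F y l -> len l < b.
  move=> y; have [/sF[b]|nP] := pselect (P y); first by exists b.
  by exists Ord0 => /nP.
have [b Hb] := Ord_replacement (fun a => B (restr x a)) (len x).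
exists b => l [y Py Fyl]; have [yx _] := Px y Py.
apply: lt_trans (Hb _ yx); rewrite -simpler_restrE; last exact: Px.
exact: HB.
Qed.

Lemma small_image (x : No) (P : set No) (f : No -> No) :
  (forall y, P y -> simpler y x) -> small [set f y | y in P].
Proof.
move=> Px; have : small (\bigcup_(y in P) [set f y]).
  apply: (small_bigcup Px) => y _.
  (* A constant function on the single place below [Ord1] yields an ordinal above [len (f y)]. *)
  have [b Hb] := Ord_replacement (fun=> len (f y)) Ord1.
  by exists b => _ ->; apply: (Hb Ord0); rewrite lt_Ord1.
by case=> b Hb; exists b => _ [y Py <-]; apply: Hb; exists y.
Qed.

Lemma small_image2 (x y : No) (P Q : set No) (f : No -> No -> No) :
  (forall z, P z -> simpler z x) -> (forall z, Q z -> simpler z y) ->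
  small [set f u v | u in P & v in Q].
Proof.
move=> Px Qy; have : small (\bigcup_(u in P) [set f u v | v in Q]).
  by apply: (small_bigcup Px) => u _; apply: small_image Qy.
case=> b Hb; exists b => _ [u Pu [v Qv <-]].
by apply: Hb; exists u => //; exists v.
Qed.

(** * Surreals built sign by sign, and the existence of cuts *)

Lemma path_signP (s : Ord -> sign) (a b : Ord) :
  isSome (if b < a then Some (s b) else None) = (b < a).
Proof. by case: ifP. Qed.

Definition path (s : Ord -> sign) (a : Ord) : No := MkNo (path_signP s a).

Lemma eq_path s t a : (forall b, b < a -> s b = t b) -> path s a = path t a.
Proof. by move=> st; apply: No_eqP => c /=; case: ifP => // /st ->. Qed.

Lemma path_restr s a w : simpler w (path s a) -> w = path s (len w).
Proof.
move=> [/= wa sw]; apply: No_eqP => c /=; case: ltP => cw; last exact: sgn_out.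
by rewrite sw // (lt_trans cw).
Qed.

(** Transfinite recursion for a rule that reads the surreal built so far and returns its next
    sign. *)
Lemma sign_recursion (F : No -> sign) :
  exists s : Ord -> sign, forall a, s a = F (path s a).
Proof.
(* The default [Plus] never shows, since [path] reads only the signs below [a]. *)
pose ext (a : Ord) (f : forall b, b < a -> sign) b :=
  match pselect (b < a) with left h => f b h | right _ => Plus end.
pose G (a : Ord) (f : forall b, b < a -> sign) := F (path (ext a f) a).
exists (Fix Ord_lt_wf (fun=> sign) G) => a; rewrite Fix_eq.
  congr F; apply: eq_path => b ba; rewrite /ext.
  by case: pselect.
move=> {}a f g fg; congr F; congr path.
by apply: funext => b; rewrite /ext; case: pselect.
Qed.

(* Follow the sign sequence that at each node [p] turns right if [p <= l] for
   some [l] in [L] and left otherwise; it enters the gap before leaving the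
   bound on the lengths. *)
Lemma between_nonempty (L R : set No) : (forall l r, L l -> R r -> l < r) ->
  small L -> small R -> between L R !=set0.
Proof.
move=> LR sL sR; have [b Hb] := smallU sL sR.
pose left p := exists2 l, L l & p <= l.
have [s sE] := sign_recursion (fun p => if `[< left p >] then Plus else Minus).
have turn w : simpler w (path s b) -> (w < path s b) = `[< left w >].
  move=> wp; have wE := path_restr wp; have := sgn_len_simpler wp.
  have [/= -> _] := wp; rewrite sE -wE.
  by case: asbool; case: (w < path s b).
exists (path s b); split=> [l Ll|r Rr]; rewrite ltNge le_eqVlt; apply/negP.
  (* The path is too long to be an initial segment of [l], so lying below [l] it would turn left at
     [l] itself or at a common initial segment below [l], against the rule. *)
  have lb : len l < b by apply: Hb; left.
  case/orP => [/eqP e|]; first by have := lb; rewrite -e /= ltxx.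
  move=> pl; case: (lt_split pl) => [[/= bl _]|/turn|[w [/turn wp wl pw lw]]].
  - by have := lt_trans bl lb; rewrite ltxx.
  - rewrite ltNge (ltW pl) => /esym/asboolPn; apply.
    by exists l.
  - move: wp; rewrite ltNge (ltW pw) => /esym/asboolPn; apply.
    by exists l => //; apply: ltW.
have rb : len r < b by apply: Hb; right.
have nleft w : r <= w -> ~ left w.
  by move=> rw [l Ll /(le_trans rw)]; rewrite leNgt LR.
case/orP => [/eqP e|]; first by have := rb; rewrite e /= ltxx.
move=> rp; case: (lt_split rp) => [/turn|[/= br _]|[w [wr /turn wp rw pw]]].
- by rewrite rp => /esym/asboolP/nleft; apply.
- by have := lt_trans br rb; rewrite ltxx.
- by move: wp; rewrite pw => /esym/asboolP/nleft; apply; apply: ltW.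
Qed.

Lemma between_convex L R x y w :
  between L R x -> between L R y -> x < w -> w < y -> between L R w.
Proof.
move=> [Lx _] [_ yR] xw wy; split=> [l /Lx|r /yR]; last exact: lt_trans.
by move=> lx; apply: lt_trans xw.
Qed.

(** An element of minimal length works: were it not an initial segment of another element, that
    element or, by convexity, their common initial segment would be a shorter one. *)
Lemma is_cut_exists (L R : set No) : (forall l r, L l -> R r -> l < r) ->
  small L -> small R -> exists z, is_cut L R z.
Proof.
move=> LR sL sR; have [z0 Bz0] := between_nonempty LR sL sR.
have [|a [z Bz <-] amin] := @Ord_least [set len z | z in between L R].
  by exists (len z0), z0.
have zmin w : between L R w -> ~ simpler w z.
  by move=> Bw [wz _]; apply: amin wz _; exists w.
exists z; split=> // y By; case: (ltgtP y z) => [yz|zy|->]; last by left.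
- case: (lt_split yz) => [/zmin//|zy|[w [wy wz /between_convex yw zw]]].
    by right.
  by case: (zmin w) => //; apply: yw zw.
- case: (lt_split zy) => [zy'|/zmin//|[w [wz wy /between_convex zw yw]]].
    by right.
  by case: (zmin w) => //; apply: zw yw.
Qed.

Lemma cutP (L R : set No) : (forall l r, L l -> R r -> l < r) ->
  small L -> small R -> is_cut L R (cut L R).
Proof. by move=> LR sL sR; apply: xgetPex; apply: is_cut_exists. Qed.

(** The tool for proving identities: each value would have to precede the other, and simplicity has
    no cycles. *)
Lemma is_cut_eqI L R L' R' x y : is_cut L R x -> is_cut L' R' y ->
  between L R y -> between L' R' x -> x = y.
Proof.
move=> [_ xmin] [_ ymin] /xmin[//|xy] /ymin[//|yx].
by case: (simpler_irr (simpler_trans xy yx)).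
Qed.

Lemma is_cut_cutE L R x : is_cut L R x -> cut L R = x.
Proof.
move=> cx; have c : is_cut L R (cut L R) by apply: xgetPex; exists x.
by case: (cx) (c) => [Bx _] [Bc _]; apply: is_cut_eqI c cx Bx Bc.
Qed.

(** Any representation is cofinal in the canonical one: an option above all of [L] would lie in the
    gap and be simpler than [x]. *)
Lemma is_cut_Lopt L R x y : is_cut L R x -> Lopt x y -> exists2 l, L l & y <= l.
Proof.
move=> [[Lx xR] xmin] [yx lt_yx].
have [//|/forall2NP N] := pselect (exists2 l, L l & y <= l).
have [|yE|xy] := xmin y.
- split=> [l Ll|r /xR]; last exact: lt_trans.
  by case: (N l) => // /negP; rewrite ltNge.
- by move: lt_yx; rewrite yE ltxx.
- by case: (simpler_irr (simpler_trans xy yx)).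
Qed.

Lemma is_cut_Ropt L R x y : is_cut L R x -> Ropt x y -> exists2 r, R r & r <= y.
Proof.
move=> [[Lx xR] xmin] [yx lt_xy].
have [//|/forall2NP N] := pselect (exists2 r, R r & r <= y).
have [|yE|xy] := xmin y.
- split=> [l /Lx lx|r Rr]; first exact: lt_trans lt_xy.
  by case: (N r) => // /negP; rewrite ltNge.
- by move: lt_xy; rewrite yE ltxx.
- by case: (simpler_irr (simpler_trans xy yx)).
Qed.

(** An element of the gap that [x] does not precede would be an option of [x], or be cut off from
    [x] by one, contradicting the bounds. *)
Lemma is_cut_opts x : is_cut (Lopt x) (Ropt x) x.
Proof.
split=> [|y [Ly yR]]; first by split=> y [].
case: (ltgtP y x) => [yx|xy|->]; last by left.
- case: (lt_split yx) => [s|s|[w [wy wx lt1 lt2]]]; last 2 first.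
  + by right.
  + by have := Ly w (conj wx lt2); rewrite ltNge (ltW lt1).
  + by have := Ly y (conj s yx); rewrite ltxx.
- case: (lt_split xy) => [s|s|[w [wx wy lt1 lt2]]].
  + by right.
  + by have := yR y (conj s xy); rewrite ltxx.
  + by have := yR w (conj wx lt1); rewrite ltNge (ltW lt2).
Qed.

Lemma cut_opts x : cut (Lopt x) (Ropt x) = x.
Proof. exact/is_cut_cutE/is_cut_opts. Qed.

Lemma simpler_0 x : x <> 0 -> simpler 0 x.
Proof.
move=> x0; split=> [|a]; last by rewrite ltr_Ord0.
rewrite ltNge; apply/negP => x_le; apply: x0; apply: No_eqP => a.
by rewrite /= ltr_Ord0 sgn_out // (le_trans x_le) // leNgt ltr_Ord0.
Qed.

Lemma simpler_0F x : ~ simpler x 0.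
Proof. by case; rewrite ltr_Ord0. Qed.

Lemma cut_empty L R : (forall z, ~ L z) -> (forall z, ~ R z) -> cut L R = 0.
Proof.
move=> L0 R0; apply: is_cut_cutE; split=> [|y _]; first by split=> z => [/L0|/R0].
by have [->|/simpler_0] := pselect (y = 0); [left|right].
Qed.

(** * The ordered group of surreal numbers *)

Definition addL x y : set No :=
  [set x' + y | x' in Lopt x] `|` [set x + y' | y' in Lopt y].
Definition addR x y : set No :=
  [set x' + y | x' in Ropt x] `|` [set x + y' | y' in Ropt y].

Lemma No_addC : commutative No_add.
Proof.
elim/(well_founded_ind simpler_wf) => x IHx;
  elim/(well_founded_ind simpler_wf) => y IHy.
rewrite !No_addE; congr cut; rewrite setUC; congr (_ `|` _);
  apply: eq_imagel => z [zs _];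
  by [apply: IHx|apply: IHy].
Qed.

Lemma addLC x y : addL x y = addL y x.
Proof.
by rewrite /addL setUC; congr (_ `|` _); apply: eq_imagel => z _; apply: No_addC.
Qed.

Lemma addRC x y : addR x y = addR y x.
Proof.
by rewrite /addR setUC; congr (_ `|` _); apply: eq_imagel => z _; apply: No_addC.
Qed.

(** As [cut] has a default value, the recursive equation alone gives no inequality; this asserts
    that the sum is a genuine cut. *)
Definition add_cut x y : Prop := is_cut (addL x y) (addR x y) (x + y).

Lemma add_cutC x y : add_cut x y -> add_cut y x.
Proof. by rewrite /add_cut addLC addRC No_addC. Qed.

(** The longer of [x1], [x2] has the other as an option, so the inequality is one of the bounds
    defining its sum with [y]. *)
Lemma add_cut_ltl x1 x2 y : simpler x1 x2 \/ simpler x2 x1 ->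
  add_cut x1 y -> add_cut x2 y -> x1 < x2 -> x1 + y < x2 + y.
Proof.
move=> s [[_ c1] _] [[c2 _] _] lt12; case: s => s; [apply: c2|apply: c1].
  by left; exists x1.
by left; exists x2.
Qed.

Lemma add_cut_ltr x y1 y2 : simpler y1 y2 \/ simpler y2 y1 ->
  add_cut x y1 -> add_cut x y2 -> y1 < y2 -> x + y1 < x + y2.
Proof.
by move=> s /add_cutC c1 /add_cutC c2; rewrite !(No_addC x); apply: add_cut_ltl.
Qed.

Lemma simpler_lt_comparable x y z : simpler x z -> simpler y z -> x < y ->
  simpler x y \/ simpler y x.
Proof.
by move=> xz yz; case: (simpler_comparable xz yz) => [|->|]; [left|rewrite ltxx|right].
Qed.

Lemma No_add_cut x y : add_cut x y.
Proof.
elim/(well_founded_ind simpler_wf): x y => x IHx;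
  elim/(well_founded_ind simpler_wf) => y IHy.
rewrite /add_cut No_addE; apply: cutP; last 2 first.
- by apply: smallU; [apply: (@small_image x)|apply: (@small_image y)] => z [].
- by apply: smallU; [apply: (@small_image x)|apply: (@small_image y)] => z [].
move=> _ _ [|] [u [us u_lt] <-] [|] [v [vs v_gt] <-].
- have uv := lt_trans u_lt v_gt.
  by apply: add_cut_ltl => //;
    [apply: simpler_lt_comparable us vs uv|apply: IHx|apply: IHx].
(* Options coming from different summands are compared through the sum of the two options. *)
- apply: (@lt_trans _ _ (u + v)).
    by apply: add_cut_ltr => //; [right|apply: IHx|apply: IHx].
  by apply: add_cut_ltl => //; [left|apply: IHx|apply: IHy].
- apply: (@lt_trans _ _ (v + u)).
    by apply: add_cut_ltl => //; [right|apply: IHy|apply: IHx].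
  by apply: add_cut_ltr => //; [left|apply: IHx|apply: IHx].
- have uv := lt_trans u_lt v_gt.
  by apply: add_cut_ltr => //;
    [apply: simpler_lt_comparable us vs uv|apply: IHy|apply: IHy].
Qed.

(** Comparable arguments are covered by [add_cut_ltl]; others are separated by a common initial
    segment. *)
Lemma No_ltD2r z x y : (x + z < y + z) = (x < y).
Proof.
apply: (leW_mono (le_mono (f := No_add^~ z) _)) => {}x {}y xy.
have cmp u v : simpler u v \/ simpler v u -> u < v -> u + z < v + z.
  by move=> s; apply: add_cut_ltl s _ _; apply: No_add_cut.
case: (lt_split xy) => [s|s|[w [wx wy xw wy']]].
- by apply: cmp => //; left.
- by apply: cmp => //; right.
- by apply: (lt_trans (cmp _ _ _ xw) (cmp _ _ _ wy')); [right|left].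
Qed.

Lemma No_ltD2l z x y : (z + x < z + y) = (x < y).
Proof. by rewrite !(No_addC z) No_ltD2r. Qed.

Lemma No_leD2l z x y : (z + x <= z + y) = (x <= y).
Proof. by rewrite leNgt No_ltD2l -leNgt. Qed.

(** By cofinality the bounds coming from [y] may be checked on any representation of [y]; when [y]
    is a sum, its own defining cut can serve. *)
Lemma between_add x y L R z : is_cut L R y ->
  (forall x', Lopt x x' -> x' + y < z) -> (forall l, L l -> x + l < z) ->
  (forall x', Ropt x x' -> z < x' + y) -> (forall r, R r -> z < x + r) ->
  between (addL x y) (addR x y) z.
Proof.
move=> cy xL yL xR yR; split=> _ [|] [u uo <-]; [exact: xL| |exact: xR|].
  by have [l Ll ul] := is_cut_Lopt cy uo;
    apply: le_lt_trans (yL l Ll); rewrite No_leD2l.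
by have [r Rr ru] := is_cut_Ropt cy uo;
  apply: lt_le_trans (yR r Rr) _; rewrite No_leD2l.
Qed.

Lemma No_addr0 x : x + 0 = x.
Proof.
elim/(well_founded_ind simpler_wf): x => x IH.
rewrite -[RHS]cut_opts No_addE; congr cut; apply/seteqP; split=> z /=.
- by move=> [] [u [us ?] <-]; [rewrite IH|case: (simpler_0F us)].
- by move=> [zs ?]; left; exists z; rewrite ?IH.
- by move=> [] [u [us ?] <-]; [rewrite IH|case: (simpler_0F us)].
- by move=> [zs ?]; left; exists z; rewrite ?IH.
Qed.

(** Each side is placed in the cut of the other: induction reassociates at the options, and
    monotonicity of addition finishes. *)
Lemma No_addA : associative No_add.
Proof.
elim/(well_founded_ind simpler_wf) => x IHx;
  elim/(well_founded_ind simpler_wf) => y IHy.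
elim/(well_founded_ind simpler_wf) => z IHz.
apply: is_cut_eqI (No_add_cut x (y + z)) (No_add_cut (x + y) z) _ _.
  apply: between_add (No_add_cut y z) _ _ _ _.
  - by move=> x' [s lt]; rewrite IHx // !No_ltD2r.
  - by move=> _ [|] [u [s lt] <-];
      [rewrite IHy // No_ltD2r No_ltD2l|rewrite IHz // No_ltD2l].
  - by move=> x' [s lt]; rewrite IHx // !No_ltD2r.
  - by move=> _ [|] [u [s lt] <-];
      [rewrite IHy // No_ltD2r No_ltD2l|rewrite IHz // No_ltD2l].
rewrite addLC addRC; apply: between_add (No_add_cut x y) _ _ _ _.
- by move=> z' [s lt]; rewrite (No_addC z') -IHz // !No_ltD2l.
- by move=> _ [|] [u [s lt] <-]; rewrite (No_addC z);
    [rewrite -IHx // No_ltD2r|rewrite -IHy // !No_ltD2l No_ltD2r].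
- by move=> z' [s lt]; rewrite (No_addC z') -IHz // !No_ltD2l.
- by move=> _ [|] [u [s lt] <-]; rewrite (No_addC z);
    [rewrite -IHx // No_ltD2r|rewrite -IHy // !No_ltD2l No_ltD2r].
Qed.

(** Of a left and a right option of [x], one is an option of the other, so the induction hypothesis
    orders their negatives. *)
Lemma No_opp_cut x : is_cut [set - y | y in Ropt x] [set - y | y in Lopt x] (- x).
Proof.
elim/(well_founded_ind simpler_wf): x => x IH; rewrite No_oppE; apply: cutP.
- move=> _ _ [r [rs r_gt] <-] [l [ls l_lt] <-]; have lr := lt_trans l_lt r_gt.
  have [s|s] := simpler_lt_comparable ls rs lr.
    by have [[_ +] _] := IH r rs; apply; exists l.
  by have [[+ _] _] := IH l ls; apply; exists r.
- by apply: (@small_image x) => y [].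
- by apply: (@small_image x) => y [].
Qed.

Lemma No_ltN x y : x < y -> - y < - x.
Proof.
have opp_ltL u v : Lopt v u -> - v < - u.
  by move=> uv; have [[_ +] _] := No_opp_cut v; apply; exists u.
have opp_ltR u v : Ropt v u -> - u < - v.
  by move=> uv; have [[+ _] _] := No_opp_cut v; apply; exists u.
move=> xy; case: (lt_split xy) => [s|s|[w [wx wy xw wy']]].
- exact: opp_ltL.
- exact: opp_ltR.
- by apply: (@lt_trans _ _ (- w)); [apply: opp_ltL|apply: opp_ltR].
Qed.

Lemma No_addrN x : x - x = 0.
Proof.
elim/(well_founded_ind simpler_wf): x => x IH.
rewrite No_addE; apply: is_cut_cutE.
have [_ xmin] := No_add_cut x (- x).
suff B : between (addL x (- x)) (addR x (- x)) 0.
  by split=> // y _; have [->|/simpler_0] := pselect (y = 0); [left|right].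
apply: between_add (No_opp_cut x) _ _ _ _.
(* Here and below, 0 is rewritten as [u - u] for the option [u] at hand. *)
- by move=> u [s lt]; rewrite -(IH u s) No_ltD2l No_ltN.
- by move=> _ [u [s lt] <-]; rewrite -(IH u s) No_ltD2r.
- by move=> u [s lt]; rewrite -(IH u s) No_ltD2l No_ltN.
- by move=> _ [u [s lt] <-]; rewrite -(IH u s) No_ltD2r.
Qed.

Lemma No_addAC x y z : x + y + z = x + z + y.
Proof. by rewrite -!No_addA (No_addC y). Qed.

Lemma No_addrK x y : x + y - y = x.
Proof. by rewrite -No_addA No_addrN No_addr0. Qed.

Lemma No_subrK x y : x - y + y = x.
Proof. by rewrite No_addAC No_addrK. Qed.

Lemma No_ltBl x y z : (x - y < z) = (x < z + y).
Proof. by rewrite -(No_ltD2r y) No_subrK. Qed.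

Lemma No_ltBr x y z : (x < y - z) = (x + z < y).
Proof. by rewrite -(No_ltD2r z) No_subrK. Qed.

Lemma No_add0r x : 0 + x = x.
Proof. by rewrite No_addC No_addr0. Qed.

Lemma No_subr0 x : x - 0 = x.
Proof. by rewrite -{1}(No_addr0 x) No_addrK. Qed.

(** * Multiplication *)

(** Conway's option formula, formally [x * y - (x - x') * (y - y')]; the sign of the last product
    decides the side of the option. *)
Definition mul_term x y x' y' : No := x' * y + x * y' - x' * y'.

Definition mulL x y : set No :=
  [set mul_term x y x' y' | x' in Lopt x & y' in Lopt y] `|`
  [set mul_term x y x' y' | x' in Ropt x & y' in Ropt y].
Definition mulR x y : set No :=
  [set mul_term x y x' y' | x' in Lopt x & y' in Ropt y] `|`
  [set mul_term x y x' y' | x' in Ropt x & y' in Lopt y].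

Definition mul_cut x y : Prop := is_cut (mulL x y) (mulR x y) (x * y).

(* The inequality is one of the bounds defining [x * y], for [x] the longer of
   [x1], [x2] and [y] the longer of [y1], [y2]. *)
Lemma mul_cut_lt x1 x2 y1 y2 : simpler x1 x2 \/ simpler x2 x1 ->
  simpler y1 y2 \/ simpler y2 y1 ->
  (forall x y, x = x1 \/ x = x2 -> y = y1 \/ y = y2 -> mul_cut x y) ->
  x1 < x2 -> y1 < y2 -> x1 * y2 + x2 * y1 < x1 * y1 + x2 * y2.
Proof.
move=> [sx|sx] [sy|sy] cxy ltx lty.
- have [[+ _] _] := cxy x2 y2 (or_intror erefl) (or_intror erefl).
  move/(_ (mul_term x2 y2 x1 y1)); rewrite No_ltBl [x2 * y2 + _]No_addC; apply.
  by left; exists x1 => //; exists y1.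
- have [[_ +] _] := cxy x2 y1 (or_intror erefl) (or_introl erefl).
  move/(_ (mul_term x2 y1 x1 y2)); rewrite No_ltBr [x2 * y1 + _]No_addC; apply.
  by left; exists x1 => //; exists y2.
- have [[_ +] _] := cxy x1 y2 (or_introl erefl) (or_intror erefl).
  move/(_ (mul_term x1 y2 x2 y1)); rewrite No_ltBr [x2 * y2 + _]No_addC; apply.
  by right; exists x2 => //; exists y1.
- have [[+ _] _] := cxy x1 y1 (or_introl erefl) (or_introl erefl).
  move/(_ (mul_term x1 y1 x2 y2)); rewrite No_ltBl [x2 * y1 + _]No_addC; apply.
  by right; exists x2 => //; exists y2.
Qed.

(** Brings the comparison of two option terms with a common summand to the form of [mul_cut_lt]. *)
Lemma No_ltDBD a b c d e : (a + e - d < b + e - c) = (a + c < b + d).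
Proof.
by rewrite No_ltBl (No_addAC (b + e)) (No_addAC b) (No_addAC (b + d)) No_ltD2r No_ltBr.
Qed.

Section MulTerm.
Variables x y : No.
Hypothesis IHx : forall x' y', simpler x' x -> mul_cut x' y'.
Hypothesis IHy : forall y', simpler y' y -> mul_cut x y'.

(** In this and the next three facts, the side of the fixed option decides whether the term
    increases or decreases in the other one. *)
Let term_ltl x1 x2 y' : simpler x1 x -> simpler x2 x -> simpler y' y -> x1 < x2 ->
  y' < y -> mul_term x y x1 y' < mul_term x y x2 y'.
Proof.
move=> s1 s2 s lt12 lt; rewrite No_ltDBD [x2 * y + _]No_addC.
apply: mul_cut_lt => //; [exact: simpler_lt_comparable s1 s2 lt12|by left|].
by move=> u v [->|->] _; apply: IHx.
Qed.

Let term_gtl x1 x2 y' : simpler x1 x -> simpler x2 x -> simpler y' y -> x1 < x2 ->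
  y < y' -> mul_term x y x2 y' < mul_term x y x1 y'.
Proof.
move=> s1 s2 s lt12 lt; rewrite No_ltDBD [x2 * y + _]No_addC.
apply: mul_cut_lt => //; [exact: simpler_lt_comparable s1 s2 lt12|by right|].
by move=> u v [->|->] _; apply: IHx.
Qed.

Let term_ltr x' y1 y2 : simpler x' x -> simpler y1 y -> simpler y2 y -> y1 < y2 ->
  x' < x -> mul_term x y x' y1 < mul_term x y x' y2.
Proof.
move=> s s1 s2 lt12 lt; rewrite /mul_term !(No_addC (x' * y)) No_ltDBD.
rewrite [x * y1 + _]No_addC [x * y2 + _]No_addC.
apply: mul_cut_lt => //; [by left|exact: simpler_lt_comparable s1 s2 lt12|].
by move=> u v [->|->] [->|->]; [apply: IHx|apply: IHx|apply: IHy|apply: IHy].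
Qed.

Let term_gtr x' y1 y2 : simpler x' x -> simpler y1 y -> simpler y2 y -> y1 < y2 ->
  x < x' -> mul_term x y x' y2 < mul_term x y x' y1.
Proof.
move=> s s1 s2 lt12 lt; rewrite /mul_term !(No_addC (x' * y)) No_ltDBD.
apply: mul_cut_lt => //; [by right|exact: simpler_lt_comparable s1 s2 lt12|].
by move=> u v [->|->] [->|->]; [apply: IHy|apply: IHy|apply: IHx|apply: IHx].
Qed.

(** In one factor the two options lie on opposite sides, in the other on the same side. Changing one
    option at a time, in an order dictated by comparing the latter two, increases the term. *)
Lemma mulL_lt_mulR l r : mulL x y l -> mulR x y r -> l < r.
Proof.
move=> [|] [x1 [sx1 lx1] [y1 [sy1 ly1] <-]] [|] [x2 [sx2 lx2] [y2 [sy2 ly2] <-]].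
- have lty := lt_trans ly1 ly2; case: (ltgtP x1 x2) => [ltx|ltx|<-].
  + exact: lt_trans (term_ltl _ _ _ ltx ly1) (term_ltr _ _ _ lty lx2).
  + exact: lt_trans (term_ltr _ _ _ lty lx1) (term_gtl _ _ _ ltx ly2).
  + exact: term_ltr.
- have ltx := lt_trans lx1 lx2; case: (ltgtP y1 y2) => [lty|lty|<-].
  + exact: lt_trans (term_ltr _ _ _ lty lx1) (term_ltl _ _ _ ltx ly2).
  + exact: lt_trans (term_ltl _ _ _ ltx ly1) (term_gtr _ _ _ lty lx2).
  + exact: term_ltl.
- have ltx := lt_trans lx2 lx1; case: (ltgtP y1 y2) => [lty|lty|<-].
  + exact: lt_trans (term_gtl _ _ _ ltx ly1) (term_ltr _ _ _ lty lx2).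
  + exact: lt_trans (term_gtr _ _ _ lty lx1) (term_gtl _ _ _ ltx ly2).
  + exact: term_gtl.
- have lty := lt_trans ly2 ly1; case: (ltgtP x1 x2) => [ltx|ltx|<-].
  + exact: lt_trans (term_gtr _ _ _ lty lx1) (term_ltl _ _ _ ltx ly2).
  + exact: lt_trans (term_gtl _ _ _ ltx ly1) (term_gtr _ _ _ lty lx2).
  + exact: term_gtr.
Qed.
End MulTerm.

Lemma No_mul_cut x y : mul_cut x y.
Proof.
elim/(well_founded_ind simpler_wf): x y => x IHx;
  elim/(well_founded_ind simpler_wf) => y IHy.
rewrite /mul_cut No_mulE; apply: cutP.
- by apply: mulL_lt_mulR => // x' y' /IHx.
- by apply: smallU; apply: (@small_image2 x y) => z [].
- by apply: smallU; apply: (@small_image2 x y) => z [].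
Qed.

(** * Products with 0 and 1, and squares below 1 *)

Lemma No_mulr0 x : x * 0 = 0.
Proof.
by rewrite No_mulE; apply: cut_empty => z [|] [x' _ [y' [/simpler_0F]]].
Qed.

Lemma No_mul0r x : 0 * x = 0.
Proof.
by rewrite No_mulE; apply: cut_empty => z [|] [y' [/simpler_0F]].
Qed.

Lemma No_lt01 : 0 < 1.
Proof.
apply/asboolP; exists Ord0; split=> [a|]; first by rewrite ltr_Ord0.
by rewrite /= ltr_Ord0 lt_Ord1 eqxx.
Qed.

Lemma simpler_1 x : simpler x 1 -> x = 0.
Proof.
have [//|/simpler_0[lt0 _] [/=]] := pselect (x = 0).
by rewrite lt_Ord1 => /eqP lx; move: lt0; rewrite lx ltr_Ord0.
Qed.

Lemma No_mulr1 x : x * 1 = x.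
Proof.
elim/(well_founded_ind simpler_wf): x => x IH; rewrite -[RHS]cut_opts No_mulE.
have L1 : Lopt 1 0.
  split; last exact: No_lt01.
  by apply: simpler_0 => e; have := No_lt01; rewrite e ltxx.
(* As 0 is the only option of 1, every option term collapses to the option of [x]. *)
have termE u : simpler u x -> u * 1 + x * 0 - u * 0 = u.
  by move=> us; rewrite !No_mulr0 No_addr0 No_subr0 IH.
have nR y : ~ Ropt 1 y.
  by move=> [/simpler_1 -> lt]; have := lt_trans No_lt01 lt; rewrite ltxx.
congr cut; apply/seteqP; split=> z.
- move=> [|] [u [us ?] [v vo <-]]; last by case: (nR v).
  by case: vo => /simpler_1 -> _; rewrite termE.
- by move=> [us ?]; left; exists z => //; exists 0; rewrite ?termE.
- move=> [|] [u [us ?] [v vo <-]]; first by case: (nR v).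
  by case: vo => /simpler_1 -> _; rewrite termE.
- by move=> [us ?]; right; exists z => //; exists 0; rewrite ?termE.
Qed.

(** Both bounds are read off the cut of [e * e]: the options 0, 0 give the term 0, and the options
    0, 1 give the term [e]. *)
Lemma No_sqr_lt e : 0 < e -> e < 1 -> 0 < e * e /\ e * e < e.
Proof.
move=> e0 e1; have [[eL eR] _] := No_mul_cut e e.
have L0 : Lopt e 0.
  by split=> //; apply: simpler_0 => E; rewrite E ltxx in e0.
have R1 : Ropt e 1.
  (* The only predecessor of 1 is 0, which is neither [e] nor above [e]; so 1 precedes [e]. *)
  split=> //; case: (lt_split e1) => [/simpler_1 E|//|[w [_ /simpler_1 -> ew _]]].
    by rewrite E ltxx in e0.
  by have := lt_trans ew e0; rewrite ltxx.
split.
  have : mul_term e e 0 0 < e * e.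
    by apply: eL; left; exists 0 => //; exists 0.
  by rewrite /mul_term !No_mul0r No_mulr0 No_add0r No_subr0.
have : e * e < mul_term e e 0 1.
  by apply: eR; left; exists 0 => //; exists 1.
by rewrite /mul_term !No_mul0r No_mulr1 No_add0r No_subr0.
Qed.

(** * Discreteness and omnific integers *)

Lemma Oz_ge1 x : Oz x -> 0 < x -> 1 <= x.
Proof.
move=> [_ xmin] x0; rewrite leNgt; apply/negP => x1.
(* 0 belongs to the interval whose simplest element is [x]. *)
have [||/simpler_0F//] := xmin 0.
  split=> _ ->; first by rewrite No_ltBl No_add0r.
  by apply: lt_trans x0 _; rewrite -{1}(No_addr0 x) No_ltD2l No_lt01.
by move=> E; rewrite E ltxx in x0.
Qed.

Lemma discrete_ge1 A : subdomain_of [set: No] A -> discrete A ->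
  forall x, A x -> 0 < x -> 1 <= x.
Proof.
move=> [_ A1 _ AM] [e [Ae e0 emin]] x Ax x0.
apply: le_trans (emin x Ax x0); rewrite leNgt; apply/negP => e1.
have [ee0 ee_lt] := No_sqr_lt e0 e1.
by have := emin _ (AM _ _ Ae Ae) ee0; rewrite leNgt ee_lt.
Qed.

Theorem theorem3 (A : set No) (hA : initial_subdomain_of [set: No] A) :
  discrete A <-> initial_subdomain_of Oz A.
Proof.
have [sA [_ iA]] := hA; have [_ A1 AB AM] := sA.
split=> [/(discrete_ge1 sA) Age1|[[AOz _ _ _] _]]; last first.
  by exists 1; split=> // [|x /AOz]; [exact: No_lt01|exact: Oz_ge1].
(* Initiality in [No] restricts to [Oz], so only the inclusion remains. *)
suff AOz : A `<=` Oz by split; split=> // x y Ax _; apply: iA.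
(* The difference [v - u] is a positive element of [A], hence at least 1. *)
have gap u v : A u -> A v -> u < v -> ~ v < u + 1.
  move=> Au Av uv; rewrite No_addC -No_ltBl => vu; move: (vu).
  by rewrite ltNge Age1 //; [exact: AB|rewrite No_ltBr No_add0r].
move=> x Ax; split.
  split=> _ ->; first by rewrite No_ltBl -{1}(No_addr0 x) No_ltD2l No_lt01.
  by rewrite -{1}(No_addr0 x) No_ltD2l No_lt01.
move=> y [/(_ _ erefl) xy /(_ _ erefl) yx]; rewrite No_ltBl in xy.
(* Unless [x] precedes [y], either [y] or an initial segment between the two precedes [x]; it is
   then in [A] and contradicts [gap]. *)
case: (ltgtP y x) => [lt|lt|->]; last by left.
- case: (lt_split lt) => [s|s|[w [_ s yw wx]]]; last 2 first.
  + by right.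
  + by case: (gap w x (iA _ _ Ax I s) Ax wx); apply: lt_trans xy _; rewrite No_ltD2r.
  + by case: (gap y x (iA _ _ Ax I s) Ax lt).
- case: (lt_split lt) => [s|s|[w [s _ xw wy]]].
  + by right.
  + by case: (gap x y Ax (iA _ _ Ax I s) lt).
  + by case: (gap x w Ax (iA _ _ Ax I s) xw); apply: lt_trans yx.
Qed.
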